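(* Let $\mathbb{T}\subseteq\mathbb{R}$ be an arbitrary time scale with forward graininess function $\mu$. Then for every $t\in\mathbb{T}$, $$\sin_{\mathbb{T}}^2(t)+\cos_{\mathbb{T}}^2(t)=\frac{2\,(1-\cos\mu(t))}{\mu(t)^2},$$ where $\sin_{\mathbb{T}}$ and $\cos_{\mathbb{T}}$ are the time-scale sine and cosine functions, and expressions of the form $0/0$ at $\mu(t)=0$ are replaced by their limits as $\mu(t)\to 0$ (so that the right-hand side equals $1$ when $\mu(t)=0$).
   Context: A time scale $\mathbb{T}$ is a nonempty closed subset of $\mathbb{R}$. The forward jump operator is $\sigma(t)=\inf\{s\in\mathbb{T}: s>t\}$ for $t\in\mathbb{T}$, $t\neq\sup\mathbb{T}$, and $\sigma(\sup\mathbb{T})=\sup\mathbb{T}$ if $\sup\mathbb{T}<+\infty$. The forward graininess function is $\mu:\mathbb{T}\to[0,\infty)$, $\mu(t)=\sigma(t)-t$. The time-scale sine and cosine $\sin_{\mathbb{T}},\cos_{\mathbb{T}}:\mathbb{T}\to\mathbb{R}$ are defined by $$\sin_{\mathbb{T}}(t)=\frac{\sin t\,\sin\mu(t)-\cos t\,(\cos\mu(t)-1)}{\mu(t)},\qquad \cos_{\mathbb{T}}(t)=\frac{\sin t\,(\cos\mu(t)-1)+\cos t\,\sin\mu(t)}{\mu(t)}.$$ Convention: when $\mu(t)=0$, an expression of the form $0/0$ is interpreted as its limit as the value $\mu(t)$ is replaced by a real variable $\mu\to0$ with $t$ fixed; thus $\sin_{\mathbb{T}}(t)=\sin t$ and $\cos_{\mathbb{T}}(t)=\cos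 t$ when $\mu(t)=0$. *)

(* Defs.v *)
From HB Require Import structures.
From mathcomp Require Import all_boot all_order all_algebra.
From mathcomp Require Import all_classical all_reals all_analysis.

Set Implicit Arguments.
Unset Strict Implicit.
Unset Printing Implicit Defensive.

Import Order.TTheory GRing.Theory Num.Theory.
Import numFieldNormedType.Exports.

Local Open Scope classical_set_scope.
Local Open Scope ring_scope.

Definition time_scale (R : realType) (T : set R) : Prop :=
  T !=set0 /\ closed T.

(* The supremum is taken in the extended reals: the real-valued [sup] of a set
   that is not bounded above is 0, which could be an element of T. *)
Definition forward_jump (R : realType) (T : set R) (t : R) : R :=
  if t%:E == ereal_sup [set x%:E | x in T] then t
  else inf [set s | T s /\ t < s].

Definition graininess (R : realType) (T : set R) (t : R) : R :=
  forward_jump T t - t.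

(* The 0/0 convention: [g m], read as the limit of [g] at 0 when [m = 0]
   (evaluating a quotient there would give 0, since [x / 0 = 0]). *)
Definition eval_lim0 (R : realType) (g : R -> R) (m : R) : R :=
  if m == 0 then lim (g x @[x --> 0^']) else g m.

Definition sinT (R : realType) (T : set R) (t : R) : R :=
  eval_lim0 (fun m => (sin t * sin m - cos t * (cos m - 1)) / m)
            (graininess T t).

Definition cosT (R : realType) (T : set R) (t : R) : R :=
  eval_lim0 (fun m => (sin t * (cos m - 1) + cos t * sin m) / m)
            (graininess T t).

(* Main.v *)
Require Import Defs.
From HB Require Import structures.
From mathcomp Require Import all_boot all_order all_algebra.
From mathcomp Require Import all_classical all_reals all_analysis.
From mathcomp Require Import ring.

Set Implicit Arguments.
Unset Strict Implicit.
Unset Printing Implicit Defensive.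

Import Order.TTheory GRing.Theory Num.Theory.
Import numFieldNormedType.Exports.

Local Open Scope classical_set_scope.
Local Open Scope ring_scope.

(** For fixed [m], the two numerators are, up to sign, the increments of [cos] and [sin] from [t] to
    [t + m]: they span a chord of the unit circle, of squared length [2 * (1 - cos m)] whatever [t]
    is. Dividing by [m ^+ 2] settles nonzero graininess ([sinT_cosT_sqr]). At zero graininess the
    three expressions are limits: [sin t] and [cos t] ([cvg_sinT], [cvg_cosT]), and 1 on the right
    ([cvg_one_sub_cos_over_sqr]), so Pythagoras concludes. *)

Lemma cvg_slope0 (R : realType) (f : R -> R) (df : R) :
  is_derive (0 : R^o) (1 : R^o) (f : R^o -> R^o) df -> (f x - f 0) / x @[x --> 0^'] --> df.
Proof.
move=> [fd <-].
have -> : (fun x => (f x - f 0) / x) = (fun h => h^-1 *: (f (h *: 1 + 0) - f 0)).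
  by apply/funext => h; rewrite addr0 [h *: 1]mulr1 mulrC.
(* Derivability is convergence of this quotient to its own limit, which is the derivative by
   definition. *)
exact: fd.
Qed.

Lemma cvg_sin_over_id (R : realType) : sin x / x @[x --> (0 : R)^'] --> (1 : R).
Proof.
have := cvg_slope0 (is_derive_sin (0 : R)).
by rewrite cos0 sin0; under eq_fun do rewrite subr0.
Qed.

Lemma cvg_cos_sub1_over_id (R : realType) :
  (cos x - 1) / x @[x --> (0 : R)^'] --> (0 : R).
Proof.
by have := cvg_slope0 (is_derive_cos (0 : R)); rewrite cos0 sin0 oppr0.
Qed.

(** Limits are unique, so a proved convergence replaces the abstract [lim] by a known value. *)
Lemma eval_lim0E (R : realType) (g : R -> R) (l m : R) :
  g x @[x --> 0^'] --> l -> eval_lim0 g m = if m == 0 then l else g m.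
Proof. by move=> gl; rewrite /eval_lim0; case: ifP => // _; exact: cvg_lim. Qed.

Lemma cvg_sinT (R : realType) (t : R) :
  (sin t * sin m - cos t * (cos m - 1)) / m @[m --> 0^'] --> sin t.
Proof.
(* Splitting the quotient leaves only the slopes of [sin] and [cos] at 0, with limits 1 and 0. *)
under eq_fun do rewrite mulrBl -!mulrA.
rewrite [X in nbhs X](_ : _ = sin t * 1 - cos t * 0); last by ring.
apply: cvgB; apply: cvgM; first exact: cvg_cst.
- exact: cvg_sin_over_id.
- exact: cvg_cst.
- exact: cvg_cos_sub1_over_id.
Qed.

Lemma cvg_cosT (R : realType) (t : R) :
  (sin t * (cos m - 1) + cos t * sin m) / m @[m --> 0^'] --> cos t.
Proof.
under eq_fun do rewrite mulrDl -!mulrA.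
rewrite [X in nbhs X](_ : _ = sin t * 0 + cos t * 1); last by ring.
apply: cvgD; apply: cvgM; first exact: cvg_cst.
- exact: cvg_cos_sub1_over_id.
- exact: cvg_cst.
- exact: cvg_sin_over_id.
Qed.

(* Also true at [m = 0], where both sides are [0] because [x / 0 = 0]. *)
Lemma sinT_cosT_sqr (R : realType) (t m : R) :
  ((sin t * sin m - cos t * (cos m - 1)) / m) ^+ 2 +
  ((sin t * (cos m - 1) + cos t * sin m) / m) ^+ 2 =
  2 * (1 - cos m) / m ^+ 2.
Proof.
rewrite !expr_div_n -mulrDl; congr (_ / _).
(* The cross terms cancel; the second factor is [(cos m - 1) ^+ 2 + sin m ^+ 2], expanded to expose
   a Pythagorean sum. *)
transitivity ((cos t ^+ 2 + sin t ^+ 2) *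
              ((cos m ^+ 2 + sin m ^+ 2) + 1 - 2 * cos m)); first by ring.
by rewrite !cos2Dsin2; ring.
Qed.

(** The identity read backwards at [t = 0] avoids a second-order expansion of [cos]: the limit is
    [sin 0 ^+ 2 + cos 0 ^+ 2]. *)
Lemma cvg_one_sub_cos_over_sqr (R : realType) :
  2 * (1 - cos m) / m ^+ 2 @[m --> (0 : R)^'] --> (1 : R).
Proof.
(* Rewriting for all [m] at once is sound because the identity also covers [m = 0]. *)
under eq_fun do rewrite -(sinT_cosT_sqr 0).
rewrite [X in nbhs X](_ : _ = sin 0 ^+ 2 + cos 0 ^+ 2); last first.
  by rewrite addrC cos2Dsin2.
rewrite !expr2.
apply: cvgD; apply: cvgM; by [exact: cvg_sinT | exact: cvg_cosT].
Qed.

Theorem theorem5p3 (R : realType) (T : set R) (hT : time_scale T)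
    (t : R) (ht : T t) :
  let rhs := eval_lim0 (fun m : R => 2 * (1 - cos m) / m ^+ 2)
                       (graininess T t) in
  sinT T t ^+ 2 + cosT T t ^+ 2 = rhs /\
  (graininess T t = 0 -> rhs = 1).
Proof.
rewrite /= /sinT /cosT (eval_lim0E _ (@cvg_sinT R t)) (eval_lim0E _ (@cvg_cosT R t)).
rewrite (eval_lim0E _ (@cvg_one_sub_cos_over_sqr R)).
split; last by move=> ->; rewrite eqxx.
case: eqP => _; first by rewrite addrC cos2Dsin2.
exact: sinT_cosT_sqr.
Qed.
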